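(* Let $p>1$ and let $\rho$ be any quantum state (density operator) on a $d$-dimensional Hilbert space $\mathcal{H}$. Then both $M_{l_p}(\rho\otimes\frac{\mathbb{I}}{d})$ and $M_p(\rho\otimes\frac{\mathbb{I}}{d})$ fail to satisfy monotonicity under all real operations within CPTP mappings; that is, there is a real CPTP operation $\tilde\Lambda$ on $\mathcal{H}\otimes\mathcal{H}$ with $M_{l_p}(\tilde\Lambda[\rho\otimes\frac{\mathbb{I}}{d}])>M_{l_p}(\rho\otimes\frac{\mathbb{I}}{d})$, and there is a real CPTP operation $\tilde\Lambda$ on $\mathcal{H}\otimes\mathcal{H}$ with $M_{p}(\tilde\Lambda[\rho\otimes\frac{\mathbb{I}}{d}])>M_{p}(\rho\otimes\frac{\mathbb{I}}{d})$.
   Context: Fix an orthonormal basis $\{|j\rangle\}_{j=0}^{d-1}$ of $\mathcal{H}$, and use the product basis on $\mathcal{H}\otimes\mathcal{H}$. $\mathbb{I}$ is the identity operator on $\mathcal{H}$. A density operator is a real state if all its matrix elements in the fixed basis are real; $\mathcal{F}$ is the set of real states (on the relevant space). A real CPTP operation is a map $\Lambda[\rho]=\sum_jK_j\rho K_j^\dagger$ with $\sum_jK_j^\dagger K_j$ equal to the identity and all matrix elements of all $K_j$ in the fixed basis real. For a matrix $A$, $\|A\|_{l_p}=\{\sum_{ij}|A_{ij}|^p\}^{1/p}$ and $\|A\|_p=[\mathrm{Tr}(A^\dagger A)^{p/2}]^{1/p}$. The induced functions are $M_{l_p}(\rho)=\min_{\sigma\in\mathcal{F}}\|\rho-\sigma\|_{l_p}$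 and $M_p(\rho)=\min_{\sigma\in\mathcal{F}}\|\rho-\sigma\|_p$. Monotonicity of a function $M$ means $M(\varepsilon(\rho))\le M(\rho)$ for real CPTP operations $\varepsilon$.
   Formalization: The claim is proved for every density operator ρ that is not a real state; for real ρ it is false, since ρ⊗I/d is then real and every real CPTP operation keeps it real, so both measures stay equal to 0. *)

(* Defs.v *)
From HB Require Import structures.
From mathcomp Require Import all_boot all_order all_algebra.
From mathcomp Require Import all_classical all_reals all_analysis.
From mathcomp Require Import complex.
(* Not imported: the notation [A ^t k] of this file would compete with the
   adjoint [A ^t*] of spectral. *)
From mathcomp Require mxtens.

Set Implicit Arguments.
Unset Strict Implicit.
Unset Printing Implicit Defensive.

Import Order.TTheory GRing.Theory Num.Theory.

Local Open Scope ring_scope.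
Local Open Scope complex_scope.
Local Open Scope sesquilinear_scope.
Local Open Scope classical_set_scope.

(* Operators on C^n are identified with their matrices in the fixed orthonormal
   basis; [mxtens.tensmx] is the Kronecker product, i.e. the tensor product
   written in the product basis. *)
Notation "A ⊗ B" := (mxtens.tensmx A B)
  (at level 40, left associativity) : ring_scope.

Section Defs.
Context {R : realType}.

(* The order of R[i] is partial: [0 <= z] says that z is real and nonnegative. *)
Definition psdmx n (A : 'M[R[i]]_n) : Prop :=
  A \is hermsymmx /\ forall v : 'cV[R[i]]_n, 0 <= (v ^t* *m A *m v) 0 0.

Definition density n (rho : 'M[R[i]]_n) : Prop := psdmx rho /\ \tr rho = 1.

Definition maximally_mixed n : 'M[R[i]]_n := (n%:R^-1)%:M.

Definition real_states n : set 'M[R[i]]_n :=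
  [set sigma | density sigma /\ sigma \is a realmx].

Definition real_cptp n (L : 'M[R[i]]_n -> 'M[R[i]]_n) : Prop :=
  exists (m : nat) (K : 'I_m -> 'M[R[i]]_n),
    [/\ forall j, K j \is a realmx,
        \sum_(j < m) (K j) ^t* *m K j = 1%:M &
        forall rho, L rho = \sum_(j < m) K j *m rho *m (K j) ^t*].

Definition lp_norm (p : R) n (A : 'M[R[i]]_n) : R :=
  (\sum_(i < n) \sum_(j < n) (Normc.normc (A i j)) `^ p) `^ p^-1.

(* Functional calculus x |-> x^s, meaningful for positive semidefinite A: the
   eigenvalues in [spectral_diag A] are then real and nonnegative, so taking
   their real part loses nothing. *)
Definition psd_powmx n (A : 'M[R[i]]_n) (s : R) : 'M[R[i]]_n :=
  invmx (spectralmx A) *m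
  diag_mx (map_mx (fun z : R[i] => ((complex.Re z) `^ s)%:C) (spectral_diag A)) *m
  spectralmx A.

(* The trace below is real and nonnegative. *)
Definition schatten_norm (p : R) n (A : 'M[R[i]]_n) : R :=
  (complex.Re (\tr (psd_powmx (A ^t* *m A) (p / 2)))) `^ p^-1.

(* For 0 < n and rho a density matrix, the sets below are nonempty and bounded
   below by 0, and the minimum is attained (the set of real states is compact),
   so that [inf] is the minimum. *)
Definition M_lp (p : R) n (rho : 'M[R[i]]_n) : R :=
  inf [set lp_norm p (rho - sigma) | sigma in @real_states n].

Definition M_schatten (p : R) n (rho : 'M[R[i]]_n) : R :=
  inf [set schatten_norm p (rho - sigma) | sigma in @real_states n].

End Defs.

Arguments maximally_mixed {R} n.
Arguments real_states {R} n.

(* Main.v *)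
(* Write [imag_mx A = (A - conj A) / 2].  For a self-adjoint A, both norms satisfy
   |imag_mx A| <= |A|, so the real state nearest to A is its entrywise real part
   and M A = |imag_mx A|.  (For the Schatten norm this is Peierls' inequality in
   an eigenbasis of [imag_mx A] and its complex conjugate, averaged by convexity
   of x^p.)  Both norms are multiplicative on H ⊗ diag e, hence
   M (rho ⊗ 1/d) = d^(1/p - 1) M rho, while the real channel that resets the
   second factor to |0><0| yields M (rho ⊗ |0><0|) = M rho, which is larger since
   M rho > 0 and d > 1. *)
Require Import Defs.
From mathcomp Require Import all_boot all_order all_algebra.
From mathcomp Require Import all_classical all_reals all_analysis.
From mathcomp Require Import complex.
From mathcomp Require mxtens.
From mathcomp Require Import ring lra.

Import Order.TTheory GRing.Theory Num.Theory.

Local Open Scope ring_scope.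
Local Open Scope complex_scope.
Local Open Scope classical_set_scope.


(** * Convexity of the power function *)

Section PowerMeans.
Context {R : realType} (p : R) (hp : 1 < p).

(** This is Young's inequality for [x] and [y ^ (p - 1)] with the conjugate exponents [p] and
    [p / (p - 1)]. It gives the tangent line at [y] without derivatives, and so covers [y = 0] as
    well. *)
Lemma powR_tangent (x y : R) : 0 <= x -> 0 <= y ->
  y `^ p + p * y `^ (p - 1) * (x - y) <= x `^ p.
Proof.
move=> x0 y0; have p0 : 0 < p by exact: lt_trans hp.
have p10 : 0 < p - 1 by rewrite subr_gt0.
pose q := p / (p - 1).
have q0 : 0 < q by rewrite divr_gt0.
have pq : p^-1 + q^-1 = 1.
  by rewrite /q invf_div -{1}(div1r p) -mulrDl subrKC mulfV// gt_eqF.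
have := conjugate_powR x0 (powR_ge0 y (p - 1)) p0 q0 pq.
rewrite -powRrM /q (mulrC (p - 1)) divfK ?gt_eqF// => young.
have yy : y * y `^ (p - 1) = y `^ p by rewrite mulr_powRB1.
have {young} : p * (x * y `^ (p - 1)) <= x `^ p + (p - 1) * y `^ p.
  move: young; rewrite -(ler_pM2l p0) => /le_trans; apply.
  by rewrite le_eqVlt; apply/orP; left; apply/eqP; field; rewrite !gt_eqF.
rewrite -subr_ge0 -[_ <= x `^ p]subr_ge0; congr (_ <= _).
by rewrite mulrBr -[p * _ * y]mulrA [_ * y]mulrC yy; ring.
Qed.

(** Average the tangent lines at the weighted mean [y]: their slopes contribute nothing, because the
    weighted sum of [x i - y] vanishes. *)
Lemma powR_jensen (I : finType) (w x : I -> R) :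
  (forall i, 0 <= w i) -> (forall i, 0 <= x i) -> \sum_i w i = 1 ->
  (\sum_i w i * x i) `^ p <= \sum_i w i * x i `^ p.
Proof.
move=> w0 x0 w1; set y := \sum_i w i * x i.
have y0 : 0 <= y by apply: sumr_ge0 => i _; exact: mulr_ge0.
have -> : y `^ p = \sum_i w i * (y `^ p + p * y `^ (p - 1) * (x i - y)).
  under eq_bigr do rewrite mulrDr mulrCA mulrBr.
  by rewrite big_split -mulr_sumr sumrB/= -!mulr_suml w1 !mul1r subrr mulr0 addr0.
by apply: ler_sum => i _; apply: ler_wpM2l => //; exact: powR_tangent.
Qed.

Lemma powR_midpoint (x y : R) : 0 <= x -> 0 <= y ->
  (2^-1 * (x + y)) `^ p <= 2^-1 * (x `^ p + y `^ p).
Proof.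
move=> x0 y0.
have := @powR_jensen bool (fun=> 2^-1) (fun b => if b then x else y).
rewrite !big_bool/= !mulrDr; apply=> //.
- by case.
- by rewrite [RHS]splitr div1r.
Qed.

End PowerMeans.

(** * Unitary diagonalization and complex conjugation of matrices *)

Section ClosedField.
Context {C : numClosedFieldType}.
Local Open Scope sesquilinear_scope.

Lemma mul_unitarymxC n (A B : 'M[C]_n) :
  A \is unitarymx -> B \is unitarymx -> A *m B^t* \is unitarymx.
Proof. by move=> Au Bu; rewrite mul_unitarymx// trmxC_unitary. Qed.

Lemma trmxC_mul m n k (A : 'M[C]_(m, n)) (B : 'M[C]_(n, k)) :
  (A *m B)^t* = B^t* *m A^t*.
Proof. by rewrite trmx_mul map_mxM. Qed.

Lemma conjmx_diag_gram n (U : 'M[C]_n) (l : 'rV[C]_n) : U \is unitarymx ->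
  (U^t* *m diag_mx l *m U)^t* *m (U^t* *m diag_mx l *m U) =
  U^t* *m diag_mx (\row_k `|l 0 k| ^+ 2) *m U.
Proof.
move=> Uu; rewrite !trmxC_mul trmxCK tr_diag_mx map_diag_mx.
rewrite !mulmxA mulmxtVK// -[X in X *m _]mulmxA mulmx_diag.
by congr (_ *m diag_mx _ *m _); apply/rowP => k; rewrite !mxE normCKC.
Qed.

Lemma hermsymmxP n (A : 'M[C]_n) : reflect (A ^t* = A) (A \is hermsymmx).
Proof.
by apply: (iffP (is_hermitianmxP _ _ _)); rewrite expr0 scale1r => /esym.
Qed.

Lemma realmxP m n (A : 'M[C]_(m, n)) :
  reflect (map_mx Num.conj A = A) (A \is a realmx).
Proof.
apply: (iffP idP) => [/realmxC//|AE]; apply/mxOverP => i j.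
by apply/CrealP; move/matrixP/(_ i j): AE; rewrite mxE.
Qed.

Lemma conjmx_diag_normal n (U : 'M[C]_n) (l : 'rV[C]_n) : U \is unitarymx ->
  U^t* *m diag_mx l *m U \is normalmx.
Proof.
move=> Uu; apply/orthomx_spectral_subproof; exists (U, l) => //=.
by rewrite invmx_unitary.
Qed.

Lemma spectralE n (A : 'M[C]_n) : A \is normalmx ->
  A = (spectralmx A)^t* *m diag_mx (spectral_diag A) *m spectralmx A.
Proof.
by move=> /orthomx_spectralP AE; rewrite -invmx_unitary ?spectral_unitarymx.
Qed.

Lemma normalmx_diag n (A : 'M[C]_n) : A \is normalmx ->
  exists2 U : 'M[C]_n, U \is unitarymx &
    exists l : 'rV[C]_n, A = U^t* *m diag_mx l *m U.
Proof.
move=> An; exists (spectralmx A); first exact: spectral_unitarymx.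
by exists (spectral_diag A); exact: spectralE.
Qed.

(** The transition matrix [V = U *m W^t*] intertwines the two diagonal matrices; entrywise this
    reads [(a i - b j) V i j = 0]. *)
Lemma transition_mx_diag n (U W : 'M[C]_n) (a b : 'rV[C]_n) i j :
  U \is unitarymx -> W \is unitarymx ->
  U^t* *m diag_mx a *m U = W^t* *m diag_mx b *m W ->
  (U *m W^t*) i j = 0 \/ a 0 i = b 0 j.
Proof.
move=> Uu Wu AE.
have /matrixP/(_ i j) : diag_mx a *m (U *m W^t*) = (U *m W^t*) *m diag_mx b.
  have := congr1 (fun X => U *m X *m W^t*) AE.
  rewrite !mulmxA (unitarymxP Uu) mul1mx => ->.
  by rewrite -[LHS]mulmxA (unitarymxP Wu) mulmx1.
rewrite mul_diag_mx mul_mx_diag !mxE.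
rewrite mulrC => /eqP; rewrite -subr_eq0 -mulrBr mulf_eq0 subr_eq0.
by case/orP => /eqP; [left|right].
Qed.

(** This is the matrix of imaginary parts multiplied by the imaginary unit; with that factor it is
    Hermitian whenever [A] is, hence unitarily diagonalizable. *)
Definition imag_mx {n} (A : 'M[C]_n) : 'M[C]_n := 2^-1 *: (A - map_mx Num.conj A).

(** Source of the lower bound on the distance: the differences of [A] with all real states share one
    imaginary part. *)
Lemma imag_mx_sub_real n (A S : 'M[C]_n) : S \is a realmx ->
  imag_mx (A - S) = imag_mx A.
Proof.
by move=> /realmxP SE; rewrite /imag_mx map_mxB SE opprB addrA subrK.
Qed.

Lemma imag_mx_herm n (A : 'M[C]_n) : A \is hermsymmx -> imag_mx A \is hermsymmx.
Proof.
move=> /hermsymmxP AE; apply/hermsymmxP/matrixP => i j.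
have Aij k l : Num.conj (A k l) = A l k by rewrite -[in RHS]AE !mxE.
by rewrite !mxE rmorphM rmorphB fmorphV rmorph_nat/= !Aij.
Qed.

(** The entries of [conj A] in the basis [W] are the conjugates of those of [A] in the basis
    [conj W]. Thus only [A] itself remains, seen in two orthonormal bases. *)
Lemma diag_entry_imag_mx n (A W : 'M[C]_n) k :
  (W *m imag_mx A *m W^t*) k k =
  2^-1 * ((W *m A *m W^t*) k k -
          Num.conj ((map_mx Num.conj W *m A *m (map_mx Num.conj W)^t*) k k)).
Proof.
have -> : Num.conj ((map_mx Num.conj W *m A *m (map_mx Num.conj W)^t*) k k) =
          (W *m map_mx Num.conj A *m W^t*) k k.
  transitivity ((map_mx Num.conj (map_mx Num.conj W *m A *m
                                  (map_mx Num.conj W)^t*)) k k).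
    by rewrite [in RHS]mxE.
  rewrite !map_mxM !map_mxCK.
  by rewrite map_trmx.
by rewrite /imag_mx -scalemxAr -scalemxAl mulmxBr mulmxBl !mxE.
Qed.

Lemma diag_entry_conj_diag n (V : 'M[C]_n) (l : 'rV[C]_n) k :
  (V *m diag_mx l *m V^t*) k k = \sum_j `|V k j| ^+ 2 * l 0 j.
Proof.
by rewrite mul_mx_diag mxE; apply: eq_bigr => j _; rewrite !mxE mulrAC normCK.
Qed.

Lemma diag_entry_conjmx n (W : 'M[C]_n) (l : 'rV[C]_n) k : W \is unitarymx ->
  (W *m (W^t* *m diag_mx l *m W) *m W^t*) k k = l 0 k.
Proof.
move=> Wu; rewrite !mulmxA (unitarymxP Wu) mul1mx -mulmxA (unitarymxP Wu).
by rewrite mulmx1 mxE eqxx.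
Qed.

Lemma imag_mx_eigenvalue n (A W : 'M[C]_n) (h : 'rV[C]_n) k :
  W \is unitarymx -> imag_mx A = W^t* *m diag_mx h *m W ->
  h 0 k = 2^-1 * ((W *m A *m W^t*) k k -
          Num.conj ((map_mx Num.conj W *m A *m (map_mx Num.conj W)^t*) k k)).
Proof.
by move=> Wu HE; rewrite -diag_entry_imag_mx HE diag_entry_conjmx.
Qed.

End ClosedField.

(** * Moduli, spectra and the Schatten norm in terms of eigenvalues *)

Section Matrices.
Context {R : realType}.
Local Notation C := R[i].
Local Open Scope sesquilinear_scope.

Lemma normcE_norm (z : C) : `|z| = (Normc.normc z)%:C.
Proof. by []. Qed.

Lemma normc_ge0 (z : C) : 0 <= Normc.normc z.
Proof. by rewrite -lecR -normcE_norm normr_ge0. Qed.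

Lemma normc_real (x : R) : Normc.normc x%:C = `|x|.
Proof.
by apply: complexI; rewrite -normcE_norm normc_def/= expr0n addr0 sqrtr_sqr.
Qed.

Lemma normc_conj (z : C) : Normc.normc (Num.conj z) = Normc.normc z.
Proof. by apply: complexI; rewrite -!normcE_norm norm_conjC. Qed.

Lemma normc_sum (I : finType) (F : I -> C) :
  Normc.normc (\sum_i F i) <= \sum_i Normc.normc (F i).
Proof.
by rewrite -lecR rmorph_sum/= -normcE_norm; exact: ler_norm_sum.
Qed.

Lemma normc_sqr (z : C) : ((Normc.normc z) ^+ 2)%:C = z * Num.conj z.
Proof. by rewrite rmorphXn/= -normcE_norm normCK. Qed.

Lemma normc_norm_sqr (z : C) : Normc.normc (`|z| ^+ 2) = Normc.normc z ^+ 2.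
Proof.
by apply: complexI; rewrite -normcE_norm normrX normr_id normcE_norm rmorphXn.
Qed.

(** Triangle inequality. It serves with [x = y] an entry of [A] for the entrywise norm, and with
    diagonal entries in two conjugate bases for the Schatten norm. *)
Lemma normc_imag_le (x y : C) :
  Normc.normc (2^-1 * (x - Num.conj y)) <=
  2^-1 * (Normc.normc x + Normc.normc y).
Proof.
have -> : (2^-1 : C) = (2^-1)%:C by rewrite fmorphV rmorph_nat.
rewrite Normc.normcM -(normc_conj y).
rewrite normc_real ger0_norm ?invr_ge0//.
rewrite ler_pM2l ?invr_gt0// -[leRHS]/(_ + _).
by rewrite -(normcN (Num.conj y)); exact: le_normcD.
Qed.

Lemma unitarymx_row_sum n (V : 'M[C]_n) k : V \is unitarymx ->
  \sum_j Normc.normc (V k j) ^+ 2 = 1.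
Proof.
move=> /unitarymxP/matrixP/(_ k k); rewrite !mxE eqxx => VE.
apply: complexI; rewrite rmorph_sum/= -[RHS]VE; apply: eq_bigr => j _.
by rewrite normc_sqr !mxE.
Qed.

Lemma unitarymx_col_sum n (V : 'M[C]_n) j : V \is unitarymx ->
  \sum_k Normc.normc (V k j) ^+ 2 = 1.
Proof.
rewrite -trmx_unitary => /(unitarymx_row_sum _ _ j) <-.
by apply: eq_bigr => k _; rewrite mxE.
Qed.

(* For two unitary diagonalizations a, b of A with transition matrix V, an entry
   [V i j] vanishes unless [a i = b j]; sum [|V i j|^2 f] along rows and
   columns. *)
Lemma spectrum_sum_uniq (f : C -> R) n (U W : 'M[C]_n) (a b : 'rV[C]_n) :
  U \is unitarymx -> W \is unitarymx ->
  U^t* *m diag_mx a *m U = W^t* *m diag_mx b *m W ->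
  \sum_k f (a 0 k) = \sum_k f (b 0 k).
Proof.
move=> Uu Wu AE; pose V := U *m W^t*.
have Vu : V \is unitarymx := mul_unitarymxC _ _ _ Uu Wu.
have fV i j : Normc.normc (V i j) ^+ 2 * f (a 0 i) =
              Normc.normc (V i j) ^+ 2 * f (b 0 j).
  case: (transition_mx_diag _ _ _ _ _ i j Uu Wu AE) => [|->//].
  by rewrite -/V => ->; rewrite Normc.normc0 expr0n !mul0r.
transitivity (\sum_i \sum_j Normc.normc (V i j) ^+ 2 * f (a 0 i)).
  by apply: eq_bigr => i _; rewrite -mulr_suml unitarymx_row_sum// mul1r.
rewrite exchange_big/=; apply: eq_bigr => j _.
by under eq_bigr do rewrite fV; rewrite -mulr_suml unitarymx_col_sum// mul1r.
Qed.

Definition sum_powR (p : R) {n} (l : 'rV[C]_n) : R :=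
  \sum_k (Normc.normc (l 0 k)) `^ p.

(** [psd_powmx] refers to the spectral decomposition chosen for [A^t* *m A], while [U] gives another
    one, with eigenvalues [|l k|^2]. The trace is the same for both by [spectrum_sum_uniq], and the
    power [p / 2] of [|l k|^2] is [|l k|^p]. *)
Lemma schatten_norm_diag (p : R) n (U : 'M[C]_n) (l : 'rV[C]_n) :
  U \is unitarymx ->
  schatten_norm p (U^t* *m diag_mx l *m U) = sum_powR p l `^ p^-1.
Proof.
move=> Uu; rewrite /schatten_norm conjmx_diag_gram//; congr (_ `^ _).
set B := _ *m U.
have BS := spectralE _ _ (conjmx_diag_normal _ _ (\row_k `|l 0 k| ^+ 2) Uu).
rewrite -/B in BS.
have -> : complex.Re (\tr (psd_powmx B (p / 2))) =
          \sum_k (complex.Re (spectral_diag B 0 k)) `^ (p / 2).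
  rewrite /psd_powmx -mulmxA mxtrace_mulC mulmxK ?spectral_unit//.
  rewrite mxtrace_diag raddf_sum/=; apply: eq_bigr => k _.
  by rewrite !mxE.
rewrite (spectrum_sum_uniq (fun z => (complex.Re z) `^ (p / 2)) _ _ _ _ _
  (spectral_unitarymx B) Uu (esym BS)).
apply: eq_bigr => k _; rewrite mxE normcE_norm -rmorphXn/=.
rewrite -powR_mulrn ?normc_ge0// -powRrM.
by rewrite mulrCA mulfV ?mulr1// pnatr_eq0.
Qed.

(* Peierls' inequality: diagonal entries of A in any orthonormal basis are
   convex combinations of the eigenvalues, with doubly stochastic weights. *)
Lemma diag_entries_powR_le (p : R) n (U W : 'M[C]_n) (l : 'rV[C]_n) : 1 < p ->
  U \is unitarymx -> W \is unitarymx ->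
  \sum_k Normc.normc ((W *m (U^t* *m diag_mx l *m U) *m W^t*) k k) `^ p
    <= sum_powR p l.
Proof.
move=> hp Uu Wu; pose V := W *m U^t*.
have Vu : V \is unitarymx := mul_unitarymxC _ _ _ Wu Uu.
have -> : W *m (U^t* *m diag_mx l *m U) *m W^t* = V *m diag_mx l *m V^t*.
  by rewrite /V trmxC_mul trmxCK !mulmxA.
pose w k j := Normc.normc (V k j) ^+ 2.
(* The columns of [w] sum to 1, which spreads the right-hand side over the rows; the rows sum to 1,
   which allows Jensen's inequality in each of them. *)
have -> : sum_powR p l = \sum_k \sum_j w k j * Normc.normc (l 0 j) `^ p.
  rewrite exchange_big; apply: eq_bigr => j _.
  by rewrite -mulr_suml unitarymx_col_sum// mul1r.
apply: ler_sum => k _.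
apply: le_trans (powR_jensen p hp _ (w k) (fun j => Normc.normc (l 0 j)) _ _ _);
  last 1 first.
- exact: unitarymx_row_sum.
- rewrite ge0_ler_powR ?nnegrE ?normc_ge0//.
  + exact: ltW (lt_trans ltr01 hp).
  + by apply: sumr_ge0 => j _; rewrite mulr_ge0 ?sqr_ge0 ?normc_ge0.
  rewrite diag_entry_conj_diag; apply: (le_trans (normc_sum _ _)).
  apply: ler_sum => j _; by rewrite Normc.normcM normc_norm_sqr.
- by move=> j; exact: sqr_ge0.
- by move=> j; exact: normc_ge0.
Qed.

(** * Passing to the imaginary part does not increase either norm *)

Lemma lp_norm_imag_le (p : R) n (A : 'M[C]_n) : 0 < p ->
  lp_norm p (imag_mx A) <= lp_norm p A.
Proof.
move=> p0; have sum0 (B : 'M[C]_n) :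
    0 <= \sum_i \sum_j Normc.normc (B i j) `^ p.
  by do 2![apply: sumr_ge0 => ? _]; exact: powR_ge0.
rewrite /lp_norm ge0_ler_powR ?nnegrE ?invr_ge0 ?(ltW p0)//.
apply: ler_sum => i _; apply: ler_sum => j _.
rewrite ge0_ler_powR ?nnegrE ?normc_ge0 ?(ltW p0)// !mxE.
apply: (le_trans (normc_imag_le _ _)).
lra.
Qed.

Lemma schatten_norm_imag_le (p : R) n (A : 'M[C]_n) : 1 < p ->
  A \is hermsymmx -> schatten_norm p (imag_mx A) <= schatten_norm p A.
Proof.
move=> hp Ah; have p0 : 0 < p := lt_trans ltr01 hp.
have [U Uu [l AE]] := normalmx_diag _ _ (hermitian_normalmx Ah).
have [W Wu [h HE]] := normalmx_diag _ _ (hermitian_normalmx (imag_mx_herm _ _ Ah)).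
have AN := etrans (congr1 (fun X => schatten_norm p X) AE)
  (schatten_norm_diag p n U l Uu).
have HN := etrans (congr1 (fun X => schatten_norm p X) HE)
  (schatten_norm_diag p n W h Wu).
rewrite AN HN ge0_ler_powR ?invr_ge0 ?(ltW p0)//;
  try by rewrite nnegrE; apply: sumr_ge0 => k _; exact: powR_ge0.
pose W' := map_mx Num.conj W.
have W'u : W' \is unitarymx by rewrite conjC_unitary.
have hE k : h 0 k = 2^-1 * ((W *m A *m W^t*) k k -
                           Num.conj ((W' *m A *m W'^t*) k k)).
  exact: imag_mx_eigenvalue.
have := diag_entries_powR_le p _ U W l hp Uu Wu.
have := diag_entries_powR_le p _ U W' l hp Uu W'u.
rewrite -AE => le1 le2.
(* The intermediate quantity is the average of the two Peierls sums, in the bases [W] and [conj W].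
   It dominates each [|h k|^p] by midpoint convexity, and each of the two sums is at most
   [sum_powR p l]. *)
apply: (@le_trans _ _ (\sum_k 2^-1 *
  (Normc.normc ((W *m A *m W^t*) k k) `^ p +
   Normc.normc ((W' *m A *m W'^t*) k k) `^ p))).
  apply: ler_sum => k _.
  apply: (le_trans _ (powR_midpoint p hp _ _ (normc_ge0 _) (normc_ge0 _))).
  rewrite ge0_ler_powR ?nnegrE ?normc_ge0 ?(ltW p0)//.
    by rewrite mulr_ge0 ?addr_ge0 ?normc_ge0 ?invr_ge0.
  by rewrite hE; exact: normc_imag_le.
rewrite -mulr_sumr big_split/= mulrC ler_pdivrMr// mulr_natr mulr2n.
exact: (lerD le2 le1).
Qed.

End Matrices.

(** * Kronecker products and entrywise real parts *)

Lemma sum_mxtens (V : nmodType) m n (F : 'I_(m * n) -> V) :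
  \sum_x F x = \sum_i \sum_k F (mxtens.mxtens_index (i, k)).
Proof.
rewrite pair_big/= (reindex (@mxtens.mxtens_index m n)).
  by apply: eq_bigr => -[i k].
by exists (@mxtens.mxtens_unindex m n) => x _;
  rewrite ?mxtens.mxtens_indexK ?mxtens.mxtens_unindexK.
Qed.

Section TensorClosedField.
Context {C : numClosedFieldType}.
Local Open Scope sesquilinear_scope.

Lemma tensmx_trC m n k l (A : 'M[C]_(m, n)) (B : 'M[C]_(k, l)) :
  (A ⊗ B)^t* = A^t* ⊗ B^t*.
Proof. by apply/matrixP => i j; rewrite !mxE rmorphM. Qed.

Lemma mxtrace_tens m n (A : 'M[C]_m) (B : 'M[C]_n) :
  \tr (A ⊗ B) = \tr A * \tr B.
Proof.
rewrite /mxtrace sum_mxtens mulr_suml; apply: eq_bigr => i _.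
by rewrite mulr_sumr; apply: eq_bigr => k _; rewrite mxtens.tensmxE.
Qed.

Lemma tensmx1 m n : (1%:M : 'M[C]_m) ⊗ (1%:M : 'M[C]_n) = 1%:M.
Proof.
apply/matrixP => x y.
case: (mxtens.mxtens_indexP x) => i k; case: (mxtens.mxtens_indexP y) => j l.
rewrite mxtens.tensmxE !mxE -natrM mulnb; congr (_ %:R).
by rewrite (can_eq (@mxtens.mxtens_indexK m n)) xpair_eqE.
Qed.

(** The Kronecker product of rows, typed as a row rather than as a matrix with [1 * 1] rows; it
    lists the eigenvalues of a product of diagonal matrices. *)
Definition tensrow {m n} (l : 'rV[C]_m) (e : 'rV[C]_n) : 'rV[C]_(m * n) :=
  \row_x (l 0 (mxtens.mxtens_unindex x).1 * e 0 (mxtens.mxtens_unindex x).2).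

Lemma tensmx_diag m n (l : 'rV[C]_m) (e : 'rV[C]_n) :
  diag_mx l ⊗ diag_mx e = diag_mx (tensrow l e).
Proof.
apply/matrixP => x y.
case: (mxtens.mxtens_indexP x) => i k; case: (mxtens.mxtens_indexP y) => j h.
rewrite mxtens.tensmxE !mxE mxtens.mxtens_indexK/=.
rewrite (can_eq (@mxtens.mxtens_indexK m n)) xpair_eqE.
by case: eqP; case: eqP; rewrite /= ?mulr0n ?mulr0 ?mul0r.
Qed.

Lemma tensmx_unitary m n (U : 'M[C]_m) : U \is unitarymx ->
  U ⊗ (1%:M : 'M[C]_n) \is unitarymx.
Proof.
move=> /unitarymxP UE; apply/unitarymxP.
by rewrite tensmx_trC mxtens.tensmx_mul UE trmx1 map_mx1 mulmx1 tensmx1.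
Qed.

Lemma tensmx_conj_diag m n (U : 'M[C]_m) (l : 'rV[C]_m) (e : 'rV[C]_n) :
  (U^t* *m diag_mx l *m U) ⊗ diag_mx e =
  (U ⊗ (1%:M : 'M[C]_n))^t* *m diag_mx (tensrow l e) *m (U ⊗ 1%:M).
Proof.
by rewrite tensmx_trC -tensmx_diag !mxtens.tensmx_mul trmx1 map_mx1 mul1mx mulmx1.
Qed.

Lemma imag_mx_tens_real m n (A : 'M[C]_m) (B : 'M[C]_n) : B \is a realmx ->
  imag_mx (A ⊗ B) = imag_mx A ⊗ B.
Proof.
move=> /realmxP BE; apply/matrixP => x y.
case: (mxtens.mxtens_indexP x) => i k; case: (mxtens.mxtens_indexP y) => j h.
have BEkh : Num.conj (B k h) = B k h by rewrite -[in RHS]BE mxE.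
rewrite mxtens.tensmxE !mxE !mxtens.mxtens_indexK/= rmorphM/= BEkh.
by rewrite -mulrBl mulrA.
Qed.

Lemma realmx_tens m n (A : 'M[C]_m) (B : 'M[C]_n) :
  A \is a realmx -> B \is a realmx -> A ⊗ B \is a realmx.
Proof.
move=> /mxOverP Ar /mxOverP Br; apply/mxOverP => x y.
by rewrite mxE rpredM.
Qed.

Lemma delta_mx_realmx m n (i : 'I_m) (j : 'I_n) :
  (delta_mx i j : 'M[C]_(m, n)) \is a realmx.
Proof. by apply/mxOverP => k l; rewrite mxE realn. Qed.

Definition real_part_mx {n} (A : 'M[C]_n) : 'M[C]_n :=
  2^-1 *: (A + map_mx Num.conj A).

Lemma sub_real_part_mx n (A : 'M[C]_n) : A - real_part_mx A = imag_mx A.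
Proof. by apply/matrixP => i j; rewrite !mxE; field. Qed.

Lemma real_part_mx_real n (A : 'M[C]_n) : real_part_mx A \is a realmx.
Proof.
apply/realmxP/matrixP => i j; rewrite !mxE rmorphM rmorphD fmorphV rmorph_nat/=.
by rewrite conjCK addrC.
Qed.

Lemma real_part_mx_herm n (A : 'M[C]_n) :
  A \is hermsymmx -> real_part_mx A \is hermsymmx.
Proof.
move=> /hermsymmxP AE; apply/hermsymmxP/matrixP => i j.
have Aij k l : Num.conj (A k l) = A l k by rewrite -[in RHS]AE !mxE.
by rewrite !mxE rmorphM rmorphD fmorphV rmorph_nat/= !Aij.
Qed.

Lemma hermsymmx_tens m n (A : 'M[C]_m) (B : 'M[C]_n) :
  A \is hermsymmx -> B \is hermsymmx -> A ⊗ B \is hermsymmx.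
Proof.
by move=> /hermsymmxP AE /hermsymmxP BE; apply/hermsymmxP; rewrite tensmx_trC AE BE.
Qed.

Lemma hermsymmxB n (A B : 'M[C]_n) :
  A \is hermsymmx -> B \is hermsymmx -> A - B \is hermsymmx.
Proof.
move=> /hermsymmxP AE /hermsymmxP BE; apply/hermsymmxP.
by rewrite linearB/= map_mxB AE BE.
Qed.

(** With [delta_mx_diag], this brings the second factor before and after the reset to the form
    [diag_mx e], on which the norms are multiplicative. *)
Lemma scalar_mx_diag n (c : C) : c%:M = diag_mx (const_mx c) :> 'M[C]_n.
Proof. by apply/matrixP => i j; rewrite !mxE. Qed.

Lemma delta_mx_diag n (i : 'I_n) :
  delta_mx i i = diag_mx (delta_mx 0 i) :> 'M[C]_n.
Proof.
apply/matrixP => j k; rewrite !mxE eqxx/=.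
have [->|jk] := eqVneq j k; first by rewrite andbb.
by case: (j =P i) jk => [->|//]; rewrite eq_sym => /negPf ->.
Qed.

(** The form of [conj A] at [v] is the conjugate of the form of [A] at [conj v], so positivity
    passes from [A] to its real part. *)
Lemma real_part_quad n (A : 'M[C]_n) (v : 'cV[C]_n) :
  (v^t* *m real_part_mx A *m v) 0 0 =
  2^-1 * ((v^t* *m A *m v) 0 0 +
    Num.conj (((map_mx Num.conj v)^t* *m A *m map_mx Num.conj v) 0 0)).
Proof.
have -> : Num.conj (((map_mx Num.conj v)^t* *m A *m map_mx Num.conj v) 0 0) =
          (v^t* *m map_mx Num.conj A *m v) 0 0.
  transitivity ((map_mx Num.conj ((map_mx Num.conj v)^t* *m A *m
                                  map_mx Num.conj v)) 0 0).
    by rewrite [in RHS]mxE.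
  rewrite !map_mxM !map_mxCK.
  by rewrite map_trmx.
by rewrite /real_part_mx -scalemxAr -scalemxAl mulmxDr mulmxDl !mxE.
Qed.

(** Up to reordering the basis, the matrix is block diagonal with [n] copies of [c *: A]; [u k] is
    the slice of [v] seen by the copy [k]. Positivity of the product follows from that of [A]. *)
Lemma tensmx_scalar_quad m n (A : 'M[C]_m) (c : C) (v : 'cV[C]_(m * n)) :
  let u k : 'cV[C]_m := \col_i (v (mxtens.mxtens_index (i, k)) 0) in
  (v^t* *m (A ⊗ (c%:M : 'M[C]_n)) *m v) 0 0 =
  c * \sum_k ((u k)^t* *m A *m u k) 0 0.
Proof.
rewrite /= mxE sum_mxtens exchange_big mulr_sumr; apply: eq_bigr => k _ /=.
rewrite [in RHS]mxE mulr_sumr; apply: eq_bigr => j _.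
rewrite !mxE sum_mxtens !mulr_suml mulr_sumr; apply: eq_bigr => i _.
rewrite (bigD1 k)//= big1 ?addr0 => [|h hk].
  by rewrite !mxE !mxtens.mxtens_indexK/= eqxx mulr1n; ring.
by rewrite !mxE !mxtens.mxtens_indexK/= (negPf hk) mulr0n !mulr0.
Qed.

End TensorClosedField.

(** * Norms of products with a diagonal factor *)

Section States.
Context {R : realType}.
Local Notation C := R[i].
Local Open Scope sesquilinear_scope.

Lemma sum_powR_tensrow (p : R) m n (l : 'rV[C]_m) (e : 'rV[C]_n) :
  sum_powR p (tensrow l e) = sum_powR p l * sum_powR p e.
Proof.
rewrite /sum_powR sum_mxtens mulr_suml; apply: eq_bigr => i _.
rewrite mulr_sumr; apply: eq_bigr => k _.
by rewrite !mxE mxtens.mxtens_indexK/= Normc.normcM powRM ?normc_ge0.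
Qed.

Lemma sum_powR_ge0 (p : R) n (l : 'rV[C]_n) : 0 <= sum_powR p l.
Proof. by apply: sumr_ge0 => k _; exact: powR_ge0. Qed.

Lemma sum_powR_delta (p : R) n (i : 'I_n) : p != 0 ->
  sum_powR p (delta_mx 0 i : 'rV[C]_n) = 1.
Proof.
move=> p0; rewrite /sum_powR (bigD1 i)//= big1 ?addr0 => [|k ki].
  by rewrite !mxE !eqxx mulr1n Normc.normc1 powR1.
(* [p != 0] matters for the zero entries: [powR] gives 0 to the power 0 the value 1. *)
by rewrite !mxE eqxx (negPf ki) mulr0n Normc.normc0 powR0.
Qed.

(** The sum is [n] times [n^-p], that is [(1/n)^(p - 1)]. The strictness of the final inequality
    comes from here. *)
Lemma sum_powR_uniform_lt1 (p : R) n : 1 < p -> (1 < n)%N ->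
  sum_powR p (const_mx n%:R^-1 : 'rV[C]_n) < 1.
Proof.
move=> hp n1; have n0 : 0 < n%:R :> R by rewrite ltr0n (ltn_trans _ n1).
rewrite /sum_powR; under eq_bigr do rewrite mxE.
have -> : Normc.normc (n%:R^-1 : C) = n%:R^-1.
  have -> : n%:R^-1 = (n%:R^-1)%:C :> C by rewrite fmorphV rmorph_nat.
  by rewrite normc_real ger0_norm ?invr_ge0 ?ltW.
have x0 : 0 < n%:R^-1 :> R by rewrite invr_gt0.
rewrite sumr_const card_ord -(mulr_powRB1 (ltW x0) (lt_trans ltr01 hp)).
rewrite -[ltLHS]mulr_natl mulrA mulfV ?gt_eqF// mul1r.
have : n%:R^-1 `^ (p - 1) < 1 `^ (p - 1).
  by rewrite gt0_ltr_powR ?subr_gt0 ?nnegrE ?ltW// invf_lt1// ltr1n.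
by rewrite powR1.
Qed.

Lemma lp_norm_tens_diag (p : R) m n (H : 'M[C]_m) (e : 'rV[C]_n) : p != 0 ->
  lp_norm p (H ⊗ diag_mx e) =
  ((\sum_i \sum_j Normc.normc (H i j) `^ p) * sum_powR p e) `^ p^-1.
Proof.
move=> p0; rewrite /lp_norm; congr (_ `^ _).
rewrite sum_mxtens mulr_suml; apply: eq_bigr => i _.
under eq_bigr do rewrite sum_mxtens.
rewrite exchange_big mulr_suml/=; apply: eq_bigr => j _.
rewrite mulr_sumr; apply: eq_bigr => k _.
rewrite (bigD1 k)//= big1 ?addr0 => [|h hk].
  by rewrite mxtens.tensmxE !mxE eqxx mulr1n Normc.normcM powRM ?normc_ge0.
rewrite mxtens.tensmxE !mxE eq_sym (negPf hk) mulr0n mulr0 Normc.normc0.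
by rewrite powR0.
Qed.

Lemma schatten_norm_tens_diag (p : R) m n (U : 'M[C]_m) (l : 'rV[C]_m)
    (e : 'rV[C]_n) : U \is unitarymx ->
  schatten_norm p ((U^t* *m diag_mx l *m U) ⊗ diag_mx e) =
  (sum_powR p l * sum_powR p e) `^ p^-1.
Proof.
move=> Uu; rewrite tensmx_conj_diag -sum_powR_tensrow.
exact: (schatten_norm_diag _ _ _ _ (tensmx_unitary _ _ _ Uu)).
Qed.

(** * Density matrices, their real parts, and nonreal states *)

Lemma real_part_mx_psd n (A : 'M[C]_n) : psdmx A -> psdmx (real_part_mx A).
Proof.
move=> [Ah Ap]; split; first exact: real_part_mx_herm.
move=> v; rewrite real_part_quad mulr_ge0 ?invr_ge0 ?ler0n// addr_ge0//.
by rewrite conjC_ge0.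
Qed.

Lemma real_part_mx_trace n (A : 'M[C]_n) : \tr A = 1 -> \tr (real_part_mx A) = 1.
Proof.
move=> trA; rewrite /real_part_mx mxtraceZ mxtraceD trace_map_mx trA rmorph1.
by rewrite -[1 + 1]/(2%:R) mulVf ?pnatr_eq0.
Qed.

Lemma scalar_mx_herm n (c : C) : c \is Num.real -> 
  (c%:M : 'M[C]_n) \is hermsymmx.
Proof.
move=> cr; apply/hermsymmxP; rewrite tr_scalar_mx map_scalar_mx/=.
by congr (_%:M); exact/CrealP.
Qed.

Lemma density_tens_mixed m n (A : 'M[C]_m) : (0 < n)%N -> density A ->
  density (A ⊗ maximally_mixed n).
Proof.
move=> n0 [[Ah Ap] trA]; split; last first.
  rewrite mxtrace_tens trA mul1r mxtrace_scalar -[LHS]mulr_natr mulVf//.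
  by rewrite pnatr_eq0 -lt0n.
split; first by rewrite hermsymmx_tens// scalar_mx_herm ?realV ?realn.
move=> v; rewrite tensmx_scalar_quad mulr_ge0 ?invr_ge0 ?ler0n//.
by apply: sumr_ge0 => k _; exact: Ap.
Qed.

Lemma real_part_tens_real_state d (rho : 'M[C]_d) : (0 < d)%N -> density rho ->
  real_states (d * d) (real_part_mx rho ⊗ maximally_mixed d).
Proof.
move=> d0 [rhop rhot]; split.
  apply: density_tens_mixed => //; split; first exact: real_part_mx_psd.
  exact: real_part_mx_trace.
apply: realmx_tens; first exact: real_part_mx_real.
by apply/mxOverP => i j; rewrite mxE rpredMn// realV realn.
Qed.

Lemma density_nonreal d (rho : 'M[C]_d) : density rho -> ~ real_states d rho ->
  (1 < d)%N /\ imag_mx rho != 0.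
Proof.
move=> hrho nr; have im0 : imag_mx rho != 0.
  apply/eqP => im0; apply: nr; split => //; apply/realmxP/eqP.
  move/eqP: im0; rewrite /imag_mx scaler_eq0 invr_eq0 pnatr_eq0/= subr_eq0.
  by rewrite eq_sym.
split => //; move: hrho => [[/hermsymmxP rhoh _] rhot].
(* Dimension 0 contradicts trace 1, and in dimension 1 a Hermitian matrix is real. *)
case: d rho rhoh rhot im0 {nr} => [|[|//]] rho rhoh rhot.
  by move: rhot; rewrite /mxtrace big_ord0 => /eqP; rewrite eq_sym oner_eq0.
move/eqP => []; apply/matrixP => i j; rewrite !ord1 !mxE -[in X in X - _]rhoh.
by rewrite !mxE subrr mulr0.
Qed.

(** * The reset channel *)

(* The channel [X ⊗ Y |-> \tr Y *: (X ⊗ |i><i|)]. *)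
Definition reset_kraus d (i : 'I_d) (j : 'I_d) : 'M[C]_(d * d) :=
  1%:M ⊗ delta_mx i j.

Definition reset d (i : 'I_d) (X : 'M[C]_(d * d)) : 'M[C]_(d * d) :=
  \sum_j reset_kraus d i j *m X *m (reset_kraus d i j)^t*.

Lemma reset_kraus_trC d (i j : 'I_d) :
  (reset_kraus d i j)^t* = 1%:M ⊗ delta_mx j i.
Proof.
by rewrite tensmx_trC trmx1 map_mx1 trmx_delta map_delta_mx.
Qed.

Lemma reset_real_cptp d (i : 'I_d) : real_cptp (reset d i).
Proof.
exists d, (reset_kraus d i); split => //.
  move=> j; apply: realmx_tens; last exact: delta_mx_realmx.
  by apply/mxOverP => k l; rewrite mxE realn.
(* Each term becomes [1 ⊗ |j><j|], and the projections [|j><j|] add up to the identity. *)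
under eq_bigr do rewrite reset_kraus_trC mxtens.tensmx_mul mul1mx mul_delta_mx.
rewrite -[RHS]tensmx1; apply/matrixP => x y; rewrite summxE.
case: (mxtens.mxtens_indexP x) => k l; case: (mxtens.mxtens_indexP y) => k' l'.
under eq_bigr do rewrite mxtens.tensmxE.
by rewrite -mulr_sumr mxtens.tensmxE -summxE -mx1_sum_delta.
Qed.

Lemma reset_tens_mixed d (i : 'I_d) (rho : 'M[C]_d) :
  reset d i (rho ⊗ maximally_mixed d) = rho ⊗ delta_mx i i.
Proof.
rewrite /reset; under eq_bigr do rewrite reset_kraus_trC !mxtens.tensmx_mul
  mul1mx mulmx1 mul_mx_scalar -scalemxAl mul_delta_mx.
rewrite sumr_const card_ord; apply/matrixP => x y.
case: (mxtens.mxtens_indexP x) => k l; case: (mxtens.mxtens_indexP y) => k' l'.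
rewrite mulmxnE !mxtens.tensmxE mxE mulrCA -mulrnAl.
rewrite -[X in X * _]mulr_natr mulVf ?mul1r//.
(* The [d] equal terms cancel the factor [1/d]; [d] is nonzero because [i] inhabits ['I_d]. *)
by rewrite pnatr_eq0; case: d i {rho x y k k' l l'} => [[]|].
Qed.

(** * Failure of monotonicity *)

(** The argument common to both norms. [N] is a family over all sizes, since multiplicativity
    relates [H] to a matrix on the product space; [S] plays the part of the [p]-th power of the norm
    of [H] and must not depend on [e]. *)
Lemma norm_distance_not_monotone (p : R) (N : forall n, 'M[C]_n -> R) d
    (rho : 'M[C]_d) : 1 < p -> density rho -> ~ real_states d rho ->
  (forall n (A : 'M[C]_n), 0 <= N n A) ->
  (forall n (A : 'M[C]_n), A \is hermsymmx -> N n (imag_mx A) <= N n A) ->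
  (forall n (H : 'M[C]_n), H \is hermsymmx -> H != 0 -> exists2 S : R, 0 < S &
     forall m (e : 'rV[C]_m),
       N (n * m)%N (H ⊗ diag_mx e) = (S * sum_powR p e) `^ p^-1) ->
  exists L : 'M[C]_(d * d) -> 'M[C]_(d * d), real_cptp L /\
    inf [set N (d * d)%N (rho ⊗ maximally_mixed d - sigma)
        | sigma in real_states (d * d)] <
    inf [set N (d * d)%N (L (rho ⊗ maximally_mixed d) - sigma)
        | sigma in real_states (d * d)].
Proof.
move=> hp hrho nr N0 Nim Ntens.
have p0 : 0 < p := lt_trans ltr01 hp.
have [d1 im0] := density_nonreal _ _ hrho nr.
have d0 : (0 < d)%N by exact: ltnW.
have [[rhoh _] _] := hrho.
have [S S0 NS] := Ntens _ _ (imag_mx_herm _ _ rhoh) im0.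
pose i0 := Ordinal d0.
have st := real_part_tens_real_state _ _ d0 hrho.
exists (reset d i0); split; first exact: reset_real_cptp.
rewrite reset_tens_mixed.
(* Upper bound before the reset: the real state [real_part_mx rho ⊗ 1/d] lies at the difference
   [imag_mx rho ⊗ 1/d]. *)
apply: (@le_lt_trans _ _ (N _ (imag_mx rho ⊗ maximally_mixed d))).
  apply: ge_inf.
    by exists 0 => _ [sigma _ <-]; exact: N0.
  exists (real_part_mx rho ⊗ maximally_mixed d) => //.
  congr (N _ _); rewrite -sub_real_part_mx.
  by apply/matrixP => x y; rewrite !mxE mulrBl.
(* The two norms compared are the [p]-th roots of [S * d^(1 - p)] and of [S]. *)
apply: (@lt_le_trans _ _ (N _ (imag_mx rho ⊗ delta_mx i0 i0))).
  rewrite /maximally_mixed scalar_mx_diag delta_mx_diag !NS.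
  rewrite sum_powR_delta ?gt_eqF// mulr1.
  rewrite gt0_ltr_powR ?invr_gt0// ?nnegrE ?mulr_ge0 ?sum_powR_ge0 ?ltW//.
  by rewrite gtr_pMr// sum_powR_uniform_lt1.
(* Lower bound after the reset: for every real [sigma], the difference has imaginary part
   [imag_mx rho ⊗ |0><0|], whose norm [Nim] bounds by that of the difference. [lb_le_inf] also asks
   for a real state to exist. *)
apply: lb_le_inf; first by eexists; exists (real_part_mx rho ⊗ maximally_mixed d).
move=> _ [sigma [[[sh _] _] sr] <-].
rewrite -imag_mx_tens_real ?delta_mx_realmx// -(imag_mx_sub_real _ _ _ sr).
apply: Nim; apply: hermsymmxB => //; apply: hermsymmx_tens => //.
by apply/hermsymmxP; rewrite trmx_delta map_delta_mx.
Qed.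

Lemma lp_norm_tens_scaling (p : R) n (H : 'M[C]_n) : 0 < p -> H != 0 ->
  exists2 S : R, 0 < S &
    forall m (e : 'rV[C]_m),
      lp_norm p (H ⊗ diag_mx e) = (S * sum_powR p e) `^ p^-1.
Proof.
move=> p0 H0; exists (\sum_i \sum_j Normc.normc (H i j) `^ p); last first.
  by move=> m e; rewrite lp_norm_tens_diag ?gt_eqF.
have s0 i : 0 <= \sum_j Normc.normc (H i j) `^ p.
  by apply: sumr_ge0 => j _; exact: powR_ge0.
rewrite lt0r sumr_ge0 ?andbT//; apply: contra_neq H0 => /eqP.
rewrite psumr_eq0// => /allP z; apply/matrixP => i j; rewrite mxE.
move: (z i (mem_index_enum i)); rewrite /= psumr_eq0 => [/allP zi|*];
  last exact: powR_ge0.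
move: (zi j (mem_index_enum j)) => /= /eqP/powR_eq0_eq0.
exact: Normc.eq0_normc.
Qed.

(** [S] is the sum of the [p]-th powers of the moduli of the eigenvalues of [H]; if it vanished, so
    would all eigenvalues, and with them [H]. *)
Lemma schatten_norm_tens_scaling (p : R) n (H : 'M[C]_n) : 0 < p ->
  H \is hermsymmx -> H != 0 ->
  exists2 S : R, 0 < S &
    forall m (e : 'rV[C]_m),
      schatten_norm p (H ⊗ diag_mx e) = (S * sum_powR p e) `^ p^-1.
Proof.
move=> p0 Hh H0.
have [U Uu [l HE]] := normalmx_diag _ _ (hermitian_normalmx Hh).
exists (sum_powR p l); last first.
  by move=> m e; rewrite HE; exact: schatten_norm_tens_diag.
rewrite lt0r sum_powR_ge0 andbT; apply: contra_neq H0 => /eqP.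
rewrite psumr_eq0 => [/allP z|*]; last exact: powR_ge0.
suff l0 : l = 0 by rewrite HE l0 linear0 mulmx0 mul0mx.
apply/rowP => k; rewrite mxE.
move: (z k (mem_index_enum k)) => /= /eqP/powR_eq0_eq0.
exact: Normc.eq0_normc.
Qed.

End States.

(** [hnonreal] excludes the real states: for these a real channel sends [rho ⊗ 1/d] to a real state
    again, both distances are 0, and no strict increase is possible. *)
Theorem theorem2 (R : realType) (p : R) (hp : 1 < p) (d : nat)
    (rho : 'M[R[i]]_d) (hrho : density rho) (hnonreal : ~ real_states d rho) :
  (exists L : 'M[R[i]]_(d * d) -> 'M[R[i]]_(d * d),
      real_cptp L /\
      M_lp p (L (rho ⊗ maximally_mixed d)) > M_lp p (rho ⊗ maximally_mixed d)) /\
  (exists L : 'M[R[i]]_(d * d) -> 'M[R[i]]_(d * d),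
      real_cptp L /\
      M_schatten p (L (rho ⊗ maximally_mixed d)) > M_schatten p (rho ⊗ maximally_mixed d)).
Proof.
have p0 : 0 < p := lt_trans ltr01 hp.
split; rewrite /M_lp /M_schatten.
  exact (norm_distance_not_monotone p (fun n => @lp_norm R p n) d rho hp hrho
    hnonreal (fun n A => powR_ge0 _ _) (fun n A _ => lp_norm_imag_le p n A p0)
    (fun n H _ => lp_norm_tens_scaling p n H p0)).
exact (norm_distance_not_monotone p (fun n => @schatten_norm R p n) d rho hp hrho
  hnonreal (fun n A => powR_ge0 _ _) (fun n A => schatten_norm_imag_le p n A hp)
  (fun n H => schatten_norm_tens_scaling p n H p0)).
Qed.
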